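(* Let $V$ be an infinite-dimensional vector space over a field $F$ with $|F|\le\mathfrak{c}$. Then $\dim_F(V^{\ast})=2^{\dim_F(V)}$.
   Context: $\mathfrak{c}=2^{\aleph_0}$, and $V^{\ast}=\mathrm{Hom}_F(V,F)$ is the (algebraic) dual space. *)

(* Defs.v *)
From HB Require Import structures.
From mathcomp Require Import all_boot all_order all_algebra.
From mathcomp Require Import all_classical.

Set Implicit Arguments.
Unset Strict Implicit.
Unset Printing Implicit Defensive.

Import GRing.Theory.
Local Open Scope classical_set_scope.
Local Open Scope ring_scope.

Definition dual (F : fieldType) (V : lmodType F) : Type := {linear V -> F^o}.

Section DualSpace.
Variables (F : fieldType) (V : lmodType F).
Implicit Types (f g h : dual V) (a b : F).

HB.instance Definition _ := gen_eqMixin (dual V).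
HB.instance Definition _ := gen_choiceMixin (dual V).

Definition dual_zero : dual V := \0 : {linear V -> F^o}.
Definition dual_opp f : dual V :=
  \- (f : {linear V -> F^o}) : {linear V -> F^o}.
Definition dual_add f g : dual V :=
  (f : {linear V -> F^o}) \+ (g : {linear V -> F^o}) : {linear V -> F^o}.
Definition dual_scale a f : dual V :=
  a \*: (f : {linear V -> F^o}) : {linear V -> F^o}.

Lemma dualP f g :
  (f : {linear V -> F^o}) =1 (g : {linear V -> F^o}) -> f = g.
Proof.
case: f g => [f [[nf] [sf]]] [g [[ng] [sg]]] /= /funext fg.
move: nf sf; rewrite fg => nf sf.
by rewrite (Prop_irrelevance nf ng) (Prop_irrelevance sf sg).
Qed.

Fact dual_addA : associative dual_add.
Proof. by move=> f g h; apply: dualP => v; exact: addrA. Qed.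

Fact dual_addC : commutative dual_add.
Proof. by move=> f g; apply: dualP => v; exact: addrC. Qed.

Fact dual_add0 : left_id dual_zero dual_add.
Proof. by move=> f; apply: dualP => v; exact: add0r. Qed.

Fact dual_addN : left_inverse dual_zero dual_opp dual_add.
Proof. by move=> f; apply: dualP => v; exact: addNr. Qed.

HB.instance Definition _ :=
  GRing.isZmodule.Build (dual V) dual_addA dual_addC dual_add0 dual_addN.

Fact dual_scaleA a b f :
  dual_scale a (dual_scale b f) = dual_scale (a * b) f.
Proof. by apply: dualP => v; exact: scalerA. Qed.

Fact dual_scale1 : left_id 1 dual_scale.
Proof. by move=> f; apply: dualP => v; exact: scale1r. Qed.

Fact dual_scaleDr : right_distributive dual_scale +%R.
Proof. by move=> a f g; apply: dualP => v; exact: scalerDr. Qed.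

Fact dual_scaleDl f : {morph dual_scale^~ f : a b / a + b}.
Proof. by move=> a b; apply: dualP => v; exact: scalerDl. Qed.

HB.instance Definition _ := GRing.Zmodule_isLmodule.Build F (dual V)
  dual_scaleA dual_scale1 dual_scaleDr dual_scaleDl.

End DualSpace.

Section HamelBasis.
Variables (F : fieldType) (V : lmodType F).
Implicit Types (B : set V) (s : seq V) (c : V -> F).

Definition lin_indep B : Prop :=
  forall s c, uniq s -> (forall v, v \in s -> B v) ->
    \sum_(v <- s) c v *: v = 0 -> forall v, v \in s -> c v = 0.

Definition spanning B : Prop :=
  forall v, exists s c,
    (forall u, u \in s -> B u) /\ v = \sum_(u <- s) c u *: u.

Definition is_basis B : Prop := lin_indep B /\ spanning B.

Definition infinite_dimensional : Prop :=
  ~ exists B, finite_set B /\ is_basis B.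

(* The dimension of V is the common cardinality of its bases; by Zorn it is
   always defined, so quantifying over the bases of V is never vacuous. *)
Lemma exists_basis : exists B, is_basis B.
Proof.
have [|B [Bfree Bmax]] := @Zorn_bigcup V lin_indep.
  move=> C Cfree Ctot s c us sC s0.
  suff [->//|[X [CX sX]]] :
      s = [::] \/ exists X, C X /\ forall v, v \in s -> X v.
    exact: Cfree CX s c us sX s0.
  elim: s sC {us s0} => [|v s IHs] sC; [by left|right].
  have [Y CY Yv] := sC v (mem_head _ _).
  have [u us|->|[X [CX sX]]] := IHs.
  - by apply: sC; rewrite inE us orbT.
  - by exists Y; split=> // u; rewrite inE => /eqP->.
  have [XY|YX] := Ctot _ _ CX CY.
  - exists Y; split=> // u; rewrite inE => /predU1P[->//|/sX]; exact: XY.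
  - exists X; split=> // u; rewrite inE => /predU1P[->|/sX//]; exact: YX.
exists B; split=> // v; apply: contrapT => vB.
have nBv : ~ B v.
  move=> Bv; apply: vB; exists [:: v], (fun=> 1); split.
    by move=> u; rewrite inE => /eqP->.
  by rewrite big_seq1 scale1r.
apply: (Bmax (v |` B)).
  by split; [move=> u; right|move=> /(_ v (or_introl erefl))].
move=> s c us sB s0.
have cv0 : v \in s -> c v = 0.
  move=> vs; apply: contrapT => /eqP cv; apply: vB.
  exists (rem v s), (fun u => - (c v)^-1 * c u); split.
    move=> u; rewrite mem_rem_uniq // inE => /andP[/eqP uv us'].
    by case: (sB u us').
  move: s0; rewrite (big_rem v) //= => /eqP; rewrite addr_eq0 => /eqP cvE.
  under eq_bigr do rewrite -scalerA.
  by rewrite -scaler_sumr scaleNr -scalerN -cvE scalerA mulVf // scale1r.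
move=> u us'; have [uE|uv] := eqVneq u v; first by rewrite uE; apply: cv0; rewrite -uE.
apply: (Bfree (rem v s) c); rewrite ?rem_uniq //.
- move=> w; rewrite mem_rem_uniq // inE => /andP[/eqP wv ws].
  by case: (sB w ws).
- have [vs|vs] := boolP (v \in s); last by rewrite rem_id.
  by move: s0; rewrite (big_rem v) //= cv0 // scale0r add0r.
- by rewrite mem_rem_uniq // inE uv.
Qed.

End HamelBasis.

(* Main.v *)
(* Let B be a basis of V, so that B * B and the set of finite sequences over B
   inject into B.  A functional is determined by its restriction B -> F, and
   F embeds into the subsets of nat, so the dual embeds into the subsets of
   B * nat, hence of B.  Conversely, to X <= B attach the functional sending the
   basis vector coding (A, A') to 1 if A' = X /\ A and to 0 otherwise, where A
   ranges over the finite subsets of B.  Given distinct X, X_1, ..., X_n, a finite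
   A meeting all the symmetric differences of X and X_i gives a basis vector, the
   code of (A, X /\ A), where the functional of X is 1 and the others vanish.
   These functionals are therefore linearly independent over any field, and by
   Steinitz exchange there are at most as many of them as elements of a basis of
   the dual. *)
Require Import Defs.
From HB Require Import structures.
From mathcomp Require Import all_boot all_order all_algebra.
From mathcomp Require Import all_classical.

Set Implicit Arguments.
Unset Strict Implicit.
Unset Printing Implicit Defensive.

Import GRing.Theory.
Local Open Scope classical_set_scope.
Local Open Scope card_scope.
Local Open Scope ring_scope.

(** * Injections and the order of cardinals *)

Definition inj_on T U (A : set T) (f : T -> U) :=
  forall x y, A x -> A y -> f x = f y -> x = y.

Lemma card_le_inj T U (A : set T) (B : set U) (f : T -> U) :
  set_fun A B f -> inj_on A f -> A #<= B.
Proof.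
move=> fAB finj.
have /injfunPex[g] : exists2 h : T -> U, set_fun A B h & set_inj A h.
  by exists f => // x y; rewrite !in_setE; exact: finj.
exact: inj_card_le g.
Qed.

Lemma card_le_fun T U (A : set T) (B : set U) (u0 : U) :
  A #<= B -> exists2 f : T -> U, set_fun A B f & inj_on A f.
Proof.
(* [pcard_leP] wants a pointed codomain; [u0] excludes the empty one. *)
move: B; elim/Ppointed: U u0 => [U u0|U _] B; first by have := no u0.
move=> /pcard_leP/injfunPex[f fAB finj]; exists f => // x y Ax Ay.
by apply: finj; rewrite in_setE.
Qed.

(** * Partial injections and comparability of cardinals *)

Section PartialInjections.
Variables T U : Type.
Implicit Types (G : set (T * U)) (K : set (set (T * U))).

(** Encoding by graphs makes the union an upper bound of a chain, as [Zorn_bigcup] requires. *)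
Definition partial_inj G :=
  (forall x y y', G (x, y) -> G (x, y') -> y = y') /\
  (forall x x' y, G (x, y) -> G (x', y) -> x = x').

Lemma chain_common K p q : total_on K subset ->
  (\bigcup_(G in K) G) p -> (\bigcup_(G in K) G) q ->
  exists2 G, K G & G p /\ G q.
Proof.
move=> Ktot [G KG Gp] [H KH Hq].
have [GH|HG] := Ktot _ _ KG KH; first by exists H => //; split=> //; exact: GH.
by exists G => //; split=> //; exact: HG.
Qed.

Lemma partial_inj_bigcup K : K `<=` partial_inj -> total_on K subset ->
  partial_inj (\bigcup_(G in K) G).
Proof.
move=> Kinj Ktot; split=> x y y' p q.
  have [G KG [Gp Gq]] := chain_common Ktot p q.
  exact: (Kinj _ KG).1 Gp Gq.
have [G KG [Gp Gq]] := chain_common Ktot p q.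
exact: (Kinj _ KG).2 Gp Gq.
Qed.

Lemma partial_inj_card_le G (A : set T) (B : set U) : partial_inj G ->
  (forall x, A x -> exists2 y, B y & G (x, y)) -> A #<= B.
Proof.
move=> [_ Ginj] AB.
have [->|/set0P[a /AB[u0 _ _]]] := eqVneq A set0; first exact: card_ge0.
have /choice[f fP] x : exists y, A x -> B y /\ G (x, y).
  by have [/AB[y By Gxy]|nAx] := pselect (A x); [exists y|exists u0].
apply: (@card_le_inj _ _ _ _ f) => [x /fP[]//|x y].
move=> /fP[_ Gx] /fP[_ Gy] fxy.
by apply: (Ginj _ _ (f x)) => //; rewrite fxy.
Qed.

End PartialInjections.

(** A maximal partial injection exhausts [A] or [B]: otherwise a pair of unmatched elements could be
    added to it. *)
Lemma card_le_total T U (A : set T) (B : set U) : A #<= B \/ B #<= A.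
Proof.
pose P (G : set (T * U)) := partial_inj G /\ forall x y, G (x, y) -> A x /\ B y.
have [K KP Ktot|G [[[Gfun Ginj] GAB] Gmax]] := @Zorn_bigcup _ P.
  split; first by apply: partial_inj_bigcup => // G /KP[].
  by move=> x y [G /KP[_ GAB] /GAB].
have [AG|] := pselect (forall x, A x -> exists2 y, B y & G (x, y)).
  by left; apply: (partial_inj_card_le (conj Gfun Ginj)).
have [BG _|+ /existsNP[a /not_implyP[Aa aG]]] :=
    pselect (forall y, B y -> exists2 x, A x & G (x, y)).
  right; apply: (@partial_inj_card_le _ _ [set q | G (q.2, q.1)]) => //.
  by split=> ? ? ? /=; [exact: Ginj|exact: Gfun].
move=> /existsNP[b /not_implyP[Bb bG]]; exfalso.
have Ga y : ~ G (a, y) by move=> Gay; apply: aG; exists y => //; case: (GAB _ _ Gay).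
have Gb x : ~ G (x, b) by move=> Gxb; apply: bG; exists x => //; case: (GAB _ _ Gxb).
apply: (Gmax ((a, b) |` G)).
  by split=> [|/(_ (a, b) (or_introl erefl))/Ga//]; exact: subsetUr.
split; last by move=> x y [[-> ->]//|/GAB].
split=> [x y y'|x x' y].
  move=> [[-> ->] [[->//]|/Ga//]|Gxy [[xa _]|]]; last exact: Gfun.
  by move: Gxy; rewrite xa => /Ga.
move=> [[-> ->] [[->//]|/Gb//]|Gxy [[_ yb]|]]; last exact: Ginj.
by move: Gxy; rewrite yb => /Gb.
Qed.

(** * Squares of infinite sets *)

Lemma card_leU_square T (D E : set T) (p : T * T -> T) d0 d1 :
  D d0 -> D d1 -> d0 <> d1 ->
  set_fun (D `*` D) D p -> inj_on (D `*` D) p ->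
  E #<= D -> exists2 c : T -> T, set_fun (D `|` E) D c & inj_on (D `|` E) c.
Proof.
move=> Dd0 Dd1 d01 pD pinj /(card_le_fun d0)[j jD jinj].
(* The tags [d0] and [d1] keep the images of [D] and of the rest of [E] apart. *)
pose c x := if x \in D then p (d0, x) else p (d1, j x).
have ED x : (D `|` E) x -> x \notin D -> E x.
  by move=> [Dx|//]; rewrite notin_setE.
exists c => [x DEx|x y].
  rewrite /c; case: (boolP (x \in D)) => [/set_mem Dx|/(ED _ DEx)/jD Djx];
    exact: pD.
move=> DEx DEy; rewrite /c.
case: (boolP (x \in D)) => [/set_mem Dx|/(ED _ DEx) Ex];
    case: (boolP (y \in D)) => [/set_mem Dy|/(ED _ DEy) Ey].
- by move/(pinj (_, _) (_, _) (conj Dd0 Dx) (conj Dd0 Dy)) => -[].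
- by move/(pinj (_, _) (_, _) (conj Dd0 Dx) (conj Dd1 (jD _ Ey))) => -[].
- by move/(pinj (_, _) (_, _) (conj Dd1 (jD _ Ex)) (conj Dd0 Dy)) => -[/esym].
- move/(pinj (_, _) (_, _) (conj Dd1 (jD _ Ex)) (conj Dd1 (jD _ Ey))) => -[].
  exact: jinj.
Qed.

Section Square.
Variables (T : Type) (B : set T).
Implicit Types (G : set ((T * T) * T)).

(** The diagonal recovers [D] from a graph whose domain is the square of [D], so Zorn's lemma can
    run on graphs alone. *)
Let dom G := [set x | exists z, G ((x, x), z)].

Let square_inj G := [/\ partial_inj G,
  forall x y z, G ((x, y), z) -> [/\ B x, dom G x, dom G y & dom G z] &
  forall x y, dom G x -> dom G y -> exists z, G ((x, y), z)].

Let square_inj_bigcup K : K `<=` square_inj -> total_on K subset ->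
  square_inj (\bigcup_(G in K) G).
Proof.
move=> Ks Ktot; split.
- by apply: partial_inj_bigcup => // G /Ks[].
- move=> x y z [G KG]; have [_ GB _] := Ks _ KG.
  move=> /GB[Bx [x' Gx] [y' Gy] [z' Gz]].
  by split=> //; [exists x'|exists y'|exists z']; exists G.
- move=> x y [x' Gx] [y' Gy].
  have [G KG [{}Gx {}Gy]] := chain_common Ktot Gx Gy.
  have [_ _ Gtot] := Ks _ KG.
  have [|z Gz] := Gtot x y _ (ex_intro _ y' Gy); first by exists x'.
  by exists z, G.
Qed.

(** A sequence of distinct elements of [B] inherits the pairing [pickle] of natural numbers; its
    first two terms become the tags. *)
Let square_inj_nat : infinite_set B ->
  exists2 G, square_inj G & exists d0 d1, [/\ dom G d0, dom G d1 & d0 <> d1].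
Proof.
move=> Binf; have [t _] := infinite_setN0 Binf.
have /(card_le_fun t)[i iB iinj] := (infiniteP B).1 Binf.
have {}iinj : injective i by move=> m n; exact: iinj.
pose G := [set ((i m.1, i m.2), i (pickle m)) | m in [set: nat * nat]].
have Gi n : dom G (i n) by exists (i (pickle (n, n))), (n, n).
exists G; last by exists (i 0%N), (i 1%N); split=> // /iinj.
split; first split.
- move=> x y z [m _ [[<- <-]]] [m' _ [/iinj m1 /iinj m2 <-]].
  by case: m m' m1 m2 => [? ?] [? ?] /= -> ->.
- move=> x y z [m _ [<- <-]] [m' _ [<- /iinj/(pcan_inj pickleK)]].
  by move=> ->.
- by move=> x y z [m _ [<- <- <-]]; split=> //; exact: iB.
- move=> x y [_ [m _ [<- _ _]]] [_ [m' _ [<- _ _]]].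
  by exists (i (pickle (m.1, m'.1))), (m.1, m'.1).
Qed.

(* [D] is the domain of a maximal injection of a square [D `*` D] into [D].  If
   its complement [B `\` D] injects into [D], then so does [B], and we are done;
   otherwise the complement contains a copy [E] of [D], and sending the new pairs
   into [E] extends the injection to [D `|` E]. *)
Lemma card_le_square : infinite_set B -> B `*` B #<= B.
Proof.
move=> /square_inj_nat[G0 G0s [d0 [d1 [G0d0 G0d1 d01]]]].
(* Joining [G0] to each graph keeps the two tags in the maximal domain. *)
have [K KP Ktot|G' [Gs Gmax]] :=
    @Zorn_bigcup _ [set G | square_inj (G0 `|` G)].
  have [->|/set0P[G1 KG1]] := eqVneq K set0.
    by rewrite /= bigcup_set0 setU0.
  rewrite /= [X in square_inj X](_ : _ =
      \bigcup_(H in [set G0 `|` G | G in K]) H).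
    apply: square_inj_bigcup => [_ [G KG <-]|_ _ [G KG <-] [H KH <-]].
      exact: KP.
    by have [GH|HG] := Ktot _ _ KG KH; [left|right]; exact: setUS.
  apply/seteqP; split=> q.
    move=> [G0q|[G KG Gq]]; first by exists (G0 `|` G1); [exists G1|left].
    by exists (G0 `|` G); [exists G|right].
  by move=> [_ [G KG <-]] [G0q|Gq]; [left|right; exists G].
set G := G0 `|` G' in Gs; have [Ginj GB Gtot] := Gs.
have {}Gmax H : G `<=` H -> square_inj H -> H `<=` G.
  move=> GH Hs; apply: contrapT => HG; apply: (Gmax H).
    split=> [q G'q|HG']; first by apply: GH; right.
    by apply: HG => q /HG'; right.
  rewrite /= [X in square_inj X](_ : _ = H) //; apply/seteqP; split=> q.
    by case=> // G0q; apply: GH; left.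
  by right.
set D := dom G.
have Dd0 : D d0 by case: G0d0 => z; exists z; left.
have Dd1 : D d1 by case: G0d1 => z; exists z; left.
have DB : D `<=` B by move=> x [z /GB[]].
have /choice[p pP] q : exists z, (D `*` D) q -> G (q, z).
  have [[/Gtot{}Gtot /Gtot]|nDq] := pselect ((D `*` D) q); last by exists d0.
  by case: q {Gtot} => x y [z Gz]; exists z.
have pD : set_fun (D `*` D) D p.
  by move=> [x y] /pP /GB[].
have pinj : inj_on (D `*` D) p.
  move=> q r /pP Gq /pP Gr pqr.
  by apply: (Ginj.2 _ _ (p q)) => //; rewrite pqr.
have [BD|DB'] := card_le_total (B `\` D) D.
  have [c cD cinj] := card_leU_square Dd0 Dd1 d01 pD pinj BD.
  have cB x : B x -> (D `|` (B `\` D)) x.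
    by move=> Bx; have [Dx|Dx] := pselect (D x); [left|right].
  apply: (@card_le_inj _ _ _ _ (fun q => p (c q.1, c q.2))) => [[x y] [/= Bx By]|].
    by apply/DB/pD; split; apply/cD/cB.
  move=> [x y] [x' y'] [/= /cB Bx /cB By] [/= /cB Bx' /cB By'].
  move/(pinj (_, _) (_, _)
    (conj (cD _ Bx) (cD _ By)) (conj (cD _ Bx') (cD _ By'))).
  by move=> [/(cinj _ _ Bx Bx')-> /(cinj _ _ By By')->].
have [j jE jinj] := card_le_fun d0 DB'.
pose E := j @` D.
have [c cD cinj] := card_leU_square Dd0 Dd1 d01 pD pinj (card_image_le j D).
exfalso.
(* [c] compresses both coordinates into [D], [p] pairs them, and [j] moves the result into [E], away
   from the values of [G], which lie in [D]. *)
pose f q := j (p (c q.1, c q.2)).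
pose H := G `|` [set r | [/\ (D `|` E) r.1.1, (D `|` E) r.1.2,
  ~ (D `*` D) r.1 & r.2 = f r.1]].
have domH : dom H = D `|` E.
  apply/seteqP; split=> x.
    by move=> [z [Gz|[]//]]; left; exists z.
  have [[z Gz] _|Dx DEx] := pselect (D x); first by exists z; left.
  by exists (f (x, x)); right; split=> // -[].
have fE q : (D `|` E) q.1 -> (D `|` E) q.2 -> E (f q).
  by move=> q1 q2; exists (p (c q.1, c q.2)) => //; apply: pD; split; apply: cD.
have ED x : E x -> ~ D x by move=> [y /jE[_ Dy] <-].
have EB x : E x -> B x by move=> [y /jE[By _] <-].
have Hs : square_inj H.
  split; first split.
  - move=> q z z' [Gz|[/= _ _ qD ->]] [Gz'|[/= _ _ q'D ->]] //.
    + exact: Ginj.1 Gz Gz'.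
    + by case: q Gz q'D => x y /GB[_ Dx Dy _] [].
    + by case: q Gz' qD => x y /GB[_ Dx Dy _] [].
  - move=> q q' z [Gz|[/= q1 q2 _ fz]] [Gz'|[/= q1' q2' _ fz']] //.
    + exact: Ginj.2 Gz Gz'.
    + by exfalso; apply: (ED z); [rewrite fz'; exact: fE|case: q Gz => ? ? /GB[]].
    + by exfalso; apply: (ED z); [rewrite fz; exact: fE|case: q' Gz' => ? ? /GB[]].
    + case: q q' q1 q2 q1' q2' fz fz' => x y [x' y'] /= q1 q2 q1' q2' ->.
      have pDc a b : (D `|` E) a -> (D `|` E) b -> (D `*` D) (c a, c b).
        by move=> /cD ? /cD.
      move/(jinj _ _ (pD _ (pDc _ _ q1 q2)) (pD _ (pDc _ _ q1' q2'))).
      move/(pinj _ _ (pDc _ _ q1 q2) (pDc _ _ q1' q2')).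
      by move=> [/(cinj _ _ q1 q1')-> /(cinj _ _ q2 q2')->].
  - rewrite domH => x y z [/GB[Bx Dx Dy Dz]|[/= q1 q2 _ ->]].
      by split=> //; left.
    split=> //; last by right; apply: fE.
    by case: q1 => [/DB|/EB].
  - rewrite domH => x y DEx DEy.
    have [[Dx Dy]|nD] := pselect ((D `*` D) (x, y)).
      by have [z Gz] := Gtot _ _ Dx Dy; exists z; left.
    by exists (f (x, y)); right.
(* The point [j d0] of [E] lies in the enlarged domain but not in [D], against maximality. *)
have [z Hz] : dom H (j d0) by rewrite domH; right; exists d0.
have /Gmax/(_ Hs _ Hz)Gz : G `<=` H by left.
by apply: (ED (j d0)); [exists d0|exists z].
Qed.

End Square.

(** * Codes of finite sequences and independent families of subsets *)

Lemma card_le_seq (T : eqType) (B : set T) : infinite_set B ->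
  [set s : seq T | forall x, x \in s -> B x] #<= B.
Proof.
move=> Binf; have [t Bt] := infinite_setN0 Binf.
have /(card_le_fun t)[i iB iinj] := (infiniteP B).1 Binf.
have {}iinj : injective i by move=> m n; exact: iinj.
have [p pB pinj] := card_le_fun t (card_le_square Binf).
have {}pinj x y x' y' : B x -> B y -> B x' -> B y' -> p (x, y) = p (x', y') ->
    x = x' /\ y = y'.
  by move=> Bx By Bx' By' /(pinj (_, _) (_, _) (conj Bx By) (conj Bx' By'))[].
(* Since [t] may itself be a value of [p], decoding is guaranteed only for a known length; hence the
   length is coded along through [i]. *)
pose enc := foldr (fun x y => p (x, y)) t.
have encB s : (forall x, x \in s -> B x) -> B (enc s).
  elim: s => //= x s IHs sB; apply: pB; split=> /=.
    by apply: sB; rewrite mem_head.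
  by apply: IHs => y ys; apply: sB; rewrite inE ys orbT.
apply: (@card_le_inj _ _ _ _ (fun s => p (i (size s), enc s))) => [s sB|s s'].
  by apply: pB; split; [exact: iB|exact: encB].
move=> sB s'B /(pinj _ _ _ _ (iB _ I) (encB _ sB) (iB _ I) (encB _ s'B))[].
move/iinj; elim: s s' sB s'B => [|x s IHs] [|x' s'] //= sB s'B [ss'].
have [Bx Bx'] : B x /\ B x' by split; [apply: sB|apply: s'B]; rewrite mem_head.
have {}sB y : y \in s -> B y by move=> ys; apply: sB; rewrite inE ys orbT.
have {}s'B y : y \in s' -> B y by move=> ys; apply: s'B; rewrite inE ys orbT.
move/(pinj _ _ _ _ Bx (encB _ sB) Bx' (encB _ s'B)) => [-> ee].
by rewrite (IHs s').
Qed.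

(** Weak form of the Fichtenholz-Kantorovich-Hausdorff theorem on independent families: one positive
    condition against finitely many negative ones is what linear independence of functionals will
    use. *)
Lemma independent_subsets (T : eqType) (B : set T) : infinite_set B ->
  exists2 S : set T -> set T, forall X, S X `<=` B &
    forall X (s : seq (set T)), X `<=` B -> (forall Y, Y \in s -> Y `<=` B) ->
      X \notin s -> exists2 b, S X b & forall Y, Y \in s -> ~ S Y b.
Proof.
move=> Binf; have [t Bt] := infinite_setN0 Binf.
have [e eB einj] := card_le_fun t (card_le_seq Binf).
have [p pB pinj] := card_le_fun t (card_le_square Binf).
pose L := [set s : seq T | forall x, x \in s -> B x].
have LF (X : set T) A : L A -> L [seq x <- A | x \in X].
  by move=> LA x; rewrite mem_filter => /andP[_ /LA].
pose S (X : set T) := [set p (e A, e [seq x <- A | x \in X]) | A in L].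
exists S => [X _ [A LA <-]|X s XB sB Xs].
  by apply: pB; split; apply: eB; [exact: LA|exact: (LF X A LA)].
(* If [A] meets the symmetric difference of [X] with every [Y] in [s], its trace on [X] differs from
   its trace on each [Y], so the code of [A] with its trace on [X] separates. *)
suff [A LA sA] : exists2 A, L A &
    forall Y, Y \in s -> exists2 x, x \in A & (x \in X) != (x \in Y).
  exists (p (e A, e [seq x <- A | x \in X])); first by exists A.
  move=> Y /sA[x xA XY] [A' LA'].
  have LFe (Z : set T) A0 : L A0 -> (B `*` B) (e A0, e [seq x <- A0 | x \in Z]).
    by move=> LA0; split; apply: eB; [exact: LA0|exact: (LF Z A0 LA0)].
  move/(pinj _ _ (LFe _ _ LA') (LFe _ _ LA)) => -[/(einj _ _ LA' LA)->].
  move/(einj _ _ (LF _ _ LA) (LF _ _ LA)) => XYA.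
  have := mem_filter (fun x => x \in X) x A.
  by rewrite -XYA mem_filter xA !andbT => /esym/eqP; rewrite (negbTE XY).
elim: s sB Xs => [|Y s IHs] sB; first by exists [::].
rewrite inE negb_or => /andP[/eqP XY Xs].
have [|A LA sA] := IHs _ Xs; first by move=> Z Zs; apply: sB; rewrite inE Zs orbT.
have [x Bx xXY] : exists2 x, B x & (x \in X) != (x \in Y).
  apply: contrapT => nx; apply: XY; apply/seteqP; split=> x.
    move=> Xx; apply: contrapT => Yx; apply: nx; exists x; first exact: XB.
    by rewrite (mem_set Xx) (memNset Yx).
  move=> Yx; apply: contrapT => Xx; apply: nx.
  exists x; first by apply: (sB Y) => //; rewrite mem_head.
  by rewrite (mem_set Yx) (memNset Xx).
exists (x :: A) => [y|Z]; first by rewrite inE => /predU1P[->|/LA].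
rewrite inE => /predU1P[->|/sA[y yA yXZ]]; first by exists x; rewrite ?mem_head.
by exists y; rewrite // inE yA orbT.
Qed.

(** * Spans, linear independence and exchange *)

Section Span.
Variables (F : fieldType) (V : lmodType F).
Implicit Types (M N : set V) (l : seq (F * V)).

(** Grouping repeated vectors yields a sum over distinct ones, the form that [lin_indep] speaks
    about. *)
Lemma lincomb_undup (W : lmodType F) l (g : V -> W) :
  \sum_(p <- l) p.1 *: g p.2 =
  \sum_(u <- undup (map snd l)) (\sum_(p <- l | p.2 == u) p.1) *: g u.
Proof.
under [RHS]eq_bigr do rewrite scaler_suml.
rewrite (exchange_big_dep xpredT) //= big_seq [RHS]big_seq.
apply: eq_bigr => p pl; rewrite -big_filter.
rewrite (perm_big [:: p.2]) ?big_seq1 //.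
apply: uniq_perm => // [|u]; first by rewrite filter_uniq ?undup_uniq.
rewrite mem_filter mem_undup inE eq_sym.
by case: eqVneq => //= ->; exact: map_f.
Qed.

(** Lists of pairs may repeat a vector, so sums and multiples of combinations are mere concatenation
    and mapping. *)
Definition span M : set V :=
  [set v | exists2 l, forall p, p \in l -> M p.2 & v = \sum_(p <- l) p.1 *: p.2].

Lemma span_subset M : M `<=` span M.
Proof.
move=> v Mv; exists [:: (1, v)] => [p|]; first by rewrite inE => /eqP->.
by rewrite big_seq1 scale1r.
Qed.

Lemma spanP M u v a : span M u -> span M v -> span M (a *: u + v).
Proof.
move=> [l lM ->] [l' l'M ->]; exists ([seq (a * p.1, p.2) | p <- l] ++ l').
  move=> p; rewrite mem_cat => /orP[/mapP[q ql ->]|/l'M//]; exact: lM ql.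
by rewrite big_cat big_map scaler_sumr /=; under eq_bigr do rewrite scalerA.
Qed.

Lemma span_trans M N : M `<=` span N -> span M `<=` span N.
Proof.
move=> MN v [l lM ->].
elim: l lM => [|p l IHl] lM; first by exists [::]; rewrite ?big_nil.
rewrite big_cons; apply: spanP; first by apply/MN/lM; rewrite mem_head.
by apply: IHl => q ql; apply: lM; rewrite inE ql orbT.
Qed.

Lemma span_spanning M v : spanning M -> span M v.
Proof.
move=> /(_ v)[s [c [sM ->]]]; exists [seq (c u, u) | u <- s].
  by move=> p /mapP[u us ->]; exact: sM.
by rewrite big_map.
Qed.

(** After grouping, every coefficient vanishes, so the relation survives any map [g] on the vectors,
    linear or not. *)
Lemma lin_indep_coef0 M l (W : lmodType F) (g : V -> W) : lin_indep M ->
  (forall p, p \in l -> M p.2) -> \sum_(p <- l) p.1 *: p.2 = 0 ->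
  \sum_(p <- l) p.1 *: g p.2 = 0.
Proof.
move=> Mfree lM; rewrite (lincomb_undup l id) lincomb_undup => l0.
rewrite big_seq big1 // => u ul.
rewrite (Mfree _ _ (undup_uniq _) _ l0) ?scale0r // => v.
by rewrite mem_undup => /mapP[p /lM Mp ->].
Qed.

Lemma lin_indep_sub M N : M `<=` N -> lin_indep N -> lin_indep M.
Proof. by move=> MN Nfree s c us sM; apply: Nfree => // v /sM/MN. Qed.

Lemma lin_indepU1 M v : lin_indep M -> ~ span M v -> lin_indep (v |` M).
Proof.
move=> Mfree vM s c us sM s0.
have sM' u : u \in rem v s -> M u.
  by rewrite mem_rem_uniq // inE => /andP[/eqP uv /sM[]].
have cv0 : v \in s -> c v = 0.
  move=> vs; apply: contrapT => /eqP cv; apply: vM.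
  exists [seq (- (c v)^-1 * c u, u) | u <- rem v s].
    by move=> p /mapP[u us' ->]; exact: sM'.
  move: s0; rewrite (big_rem v) //= => /eqP; rewrite addr_eq0 => /eqP cvE.
  rewrite big_map; under eq_bigr do rewrite -scalerA.
  by rewrite -scaler_sumr scaleNr -scalerN -cvE scalerA mulVf // scale1r.
move=> u us'; have [uE|uv] := eqVneq u v.
  by rewrite uE; apply: cv0; rewrite -uE.
apply: (Mfree (rem v s) c _ sM'); rewrite ?rem_uniq //.
- have [vs|vs] := boolP (v \in s); last by rewrite rem_id.
  by move: s0; rewrite (big_rem v) //= cv0 // scale0r add0r.
- by rewrite mem_rem_uniq // inE uv.
Qed.

(** Writing [v] as a combination over [M] gives a relation with coefficient [-1] at [v], which the
    indicator function of [v] reads off. *)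
Lemma lin_indepU1_span M v : lin_indep (v |` M) -> ~ M v -> ~ span M v.
Proof.
move=> vMfree Mv [l lM vE].
have /(lin_indep_coef0 (fun u => (u == v)%:R : F^o) vMfree) :
    \sum_(p <- (- 1, v) :: l) p.1 *: p.2 = 0.
  by rewrite big_cons -vE scaleN1r addNr.
rewrite big_cons eqxx big_seq big1 /= => [H|p pl]; last first.
  by case: eqVneq => [pv|_]; [case: Mv; rewrite -pv; exact: lM|exact: mulr0].
have : (- 1 : F) = 0.
  rewrite -[RHS]H => [|p]; first by rewrite addr0; exact/esym/mulr1.
  by rewrite inE => /predU1P[->|/lM]; [left|right].
by move/eqP; rewrite oppr_eq0 oner_eq0.
Qed.

(* Steinitz exchange by Zorn's lemma: [G] matches some vectors [x] of [L] with
   vectors [y] of [C] so that replacing each matched [x] by its [y] keeps [L]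
   linearly independent and does not identify vectors. *)
Lemma lin_indep_card_le (L C : set V) : lin_indep L -> spanning C -> L #<= C.
Proof.
move=> Lfree Cspan.
pose rest (G : set (V * V)) := [set x | L x /\ forall y, ~ G (x, y)].
pose im (G : set (V * V)) := [set y | exists x, G (x, y)].
pose P (G : set (V * V)) := [/\ partial_inj G,
  forall x y, G (x, y) -> L x /\ C y,
  rest G `&` im G `<=` set0 &
  lin_indep (rest G `|` im G)].
have [K KP Ktot|G [[Ginj GLC Gdisj Gfree] Gmax]] := @Zorn_bigcup _ P.
  split.
  - by apply: partial_inj_bigcup => // G /KP[].
  - by move=> x y [G /KP[_ GLC _ _] /GLC].
  - move=> y [[Ly yK] [x [G KG Gxy]]]; have [_ _ Gdisj _] := KP _ KG.
    by apply: (Gdisj y); split; [split=> // z Gyz; apply: (yK z); exists G|exists x].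
  have [->|/set0P[G0 KG0]] := eqVneq K set0.
    apply: lin_indep_sub Lfree; rewrite bigcup_set0.
    by move=> x [[]|[]].
  move=> s c us sK.
  (* The finitely many replacing vectors in [s] come from one member of the chain, and a vector
     unmatched in the union is unmatched in that member. *)
  suff [G KG sG] : exists2 G, K G &
      forall v, v \in s -> (rest (\bigcup_(H in K) H) `|` im G) v.
    have [_ _ _ Gfree] := KP _ KG.
    apply: (Gfree s c us) => v /sG[[Lv vK]|]; last by right.
    by left; split=> // y Gvy; apply: (vK y); exists G.
  elim: s sK {us} => [|v s IHs] sK; first by exists G0.
  have [u us|G KG sG] := IHs; first by apply: sK; rewrite inE us orbT.
  have [vK|[x [H KH Hxv]]] := sK v (mem_head _ _).
    by exists G => // u; rewrite inE => /predU1P[->|/sG//]; left.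
  have [GH|HG] := Ktot _ _ KG KH; last first.
    exists G => // u; rewrite inE => /predU1P[->|/sG//].
    by right; exists x; exact: HG.
  exists H => // u; rewrite inE => /predU1P[->|/sG[]]; first by right; exists x.
    by left.
  by move=> [y /GH Hyu]; right; exists y.
have [LG|/existsNP[a /not_implyP[La aG]]] :=
    pselect (forall x, L x -> exists2 y, C y & G (x, y)).
  exact: partial_inj_card_le Ginj LG.
exfalso; have {}aG y : ~ G (a, y).
  by move=> Gay; apply: aG; exists y => //; case: (GLC _ _ Gay).
pose M := (rest G `\ a) `|` im G.
have ra : rest G a by [].
have Ma : ~ M a by move=> [[_]|ia]; [exact|exact: (Gdisj a)].
have aM : ~ span M a.
  apply: lin_indepU1_span Ma; apply: lin_indep_sub Gfree => x.
  by move=> [->|[[rx _]|ix]]; [left|left|right].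
(* If all of [C] lay in the span of [M], so would [a]; hence some [b] in [C] can replace [a]. *)
have [b Cb bM] : exists2 b, C b & ~ span M b.
  apply: contrapT => nC; apply: aM; apply: (span_trans _ (span_spanning a Cspan)).
  by move=> b Cb; apply: contrapT => bM; apply: nC; exists b.
have restE : rest ((a, b) |` G) `<=` rest G `\ a.
  move=> x [Lx xG]; split; first by split=> // y Gxy; apply: (xG y); right.
  by move=> xa; apply: (xG b); left; rewrite xa.
have imE : im ((a, b) |` G) `<=` b |` im G.
  by move=> y [x [[_ ->]|Gxy]]; [left|right; exists x].
apply: (Gmax ((a, b) |` G)).
  by split=> [|/(_ (a, b) (or_introl erefl))/aG//]; exact: subsetUr.
have bG x : ~ G (x, b) by move=> Gxb; apply/bM/span_subset; right; exists x.
split.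
- split=> [x y y'|x x' y].
    move=> [[-> ->] [[->//]|/aG//]|Gxy [[xa _]|]]; last exact: Ginj.1.
    by move: Gxy; rewrite xa => /aG.
  move=> [[-> ->] [[->//]|/bG//]|Gxy [[_ yb]|]]; last exact: Ginj.2.
  by move: Gxy; rewrite yb => /bG.
- by move=> x y [[-> ->]//|/GLC].
- move=> y [/restE[ry ya] /imE[yb|iy]]; last exact: (Gdisj y).
  by apply/bM/span_subset; left; split; rewrite -yb.
- apply: lin_indep_sub (lin_indepU1 _ bM) => [y [/restE|/imE[->|]]|].
  + by right; left.
  + by left.
  + by right; right.
  + by apply: lin_indep_sub Gfree => x [[rx _]|ix]; [left|right].
Qed.

(** * Functionals and their values on a basis *)

Lemma dual_extension (B : set V) (g : V -> F) : is_basis B ->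
  exists f : dual V, forall b, B b -> f b = g b.
Proof.
move=> [Bfree Bspan].
have /choice[r rP] v : exists l, (forall p, p \in l -> B p.2) /\
    v = \sum_(p <- l) p.1 *: p.2.
  by have [l lB vE] := span_spanning v Bspan; exists l.
pose ev l : F := \sum_(p <- l) p.1 * g p.2.
(* The value does not depend on the chosen list: the difference of two lists for one vector is a
   relation over [B], which [lin_indep_coef0] carries over to [g]. *)
have evE l l' : (forall p, p \in l -> B p.2) -> (forall p, p \in l' -> B p.2) ->
    \sum_(p <- l) p.1 *: p.2 = \sum_(p <- l') p.1 *: p.2 -> ev l = ev l'.
  move=> lB l'B ll'.
  have lN (W : lmodType F) (h : V -> W) :
      \sum_(p <- l ++ [seq (- p.1, p.2) | p <- l']) p.1 *: h p.2 =
      \sum_(p <- l) p.1 *: h p.2 - \sum_(p <- l') p.1 *: h p.2.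
    rewrite big_cat big_map -sumrN /=.
    by under [X in _ + X]eq_bigr do rewrite scaleNr.
  apply/eqP; rewrite -subr_eq0; apply/eqP.
  rewrite -[LHS](lN _ (g : V -> F^o)); apply: (@lin_indep_coef0 B _ F^o g Bfree).
    by move=> p; rewrite mem_cat => /orP[/lB//|/mapP[q ql' ->]]; exact: (l'B q).
  by rewrite (lN _ id) ll' subrr.
pose f v : F^o := ev (r v).
have flin : linear f.
  move=> a u v; rewrite /f.
  rewrite (evE _ ([seq (a * p.1, p.2) | p <- r u] ++ r v)).
  - rewrite [a *: _](mulr_sumr (r u) xpredT _ a) /ev big_cat big_map /=.
    by under eq_bigr do rewrite -mulrA.
  - exact: (rP _).1.
  - move=> p; rewrite mem_cat => /orP[/mapP[q qu ->]|]; last exact: (rP v).1.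
    exact: (rP u).1 qu.
  - rewrite -(rP _).2 big_cat big_map /= -(rP v).2.
    congr (_ + v); rewrite [in LHS](rP u).2 scaler_sumr.
    by apply: eq_bigr => p _; rewrite scalerA.
pose phi : {linear V -> F^o} := HB.pack f (GRing.isLinear.Build _ _ _ _ f flin).
exists phi => b Bb; rewrite /= /f (evE _ [:: (1, b)]).
- by rewrite /ev big_seq1 mul1r.
- exact: (rP b).1.
- by move=> p; rewrite inE => /eqP->.
- by rewrite -(rP b).2 big_seq1 scale1r.
Qed.

Lemma dual_eq_on (B : set V) (f g : dual V) : spanning B ->
  (forall b, B b -> f b = g b) -> f = g.
Proof.
move=> Bspan fg; apply: dualP => v; have [s [c [sB ->]]] := Bspan v.
rewrite !linear_sum big_seq [RHS]big_seq; apply: eq_bigr => u /sB/fg fgu.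
by rewrite !linearZ; congr (_ *: _).
Qed.

Lemma dual_sum_apply I (s : seq I) (c : I -> F) (h : I -> dual V) v :
  (\sum_(i <- s) c i *: h i : dual V) v = \sum_(i <- s) c i * h i v.
Proof. by elim/big_ind2 : _ => // ? ? ? ? <- <-. Qed.

End Span.

(** * The two bounds for the dual space *)

Lemma card_dual_le (F : fieldType) (V : lmodType F) (B : set V) :
  [set: F] #<= [set: set nat] -> infinite_set B -> spanning B ->
  [set: dual V] #<= [set X : set V | X `<=` B].
Proof.
move=> /(card_le_fun set0)[code _ codeI] Binf Bspan.
have [t Bt] := infinite_setN0 Binf.
have [i iB iI] := card_le_fun t ((infiniteP B).1 Binf).
have [p pB pI] := card_le_fun t (card_le_square Binf).
(* The disjoint union over [b] of the sets [code (f b)], moved into [B] by [p] and [i]. *)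
pose th (f : dual V) :=
  [set p (q.1, i q.2) | q in [set q | B q.1 /\ code (f q.1) q.2]].
have thE f b n : B b -> th f (p (b, i n)) = code (f b) n.
  move=> Bb; apply/propext; split=> [[[b' n'] [/= Bb' fb']]|fb]; last by exists (b, n).
  move/(pI (_, _) (_, _) (conj Bb' (iB _ I)) (conj Bb (iB _ I))).
  by move=> [<- /(iI _ _ I I)<-].
apply: (@card_le_inj _ _ _ _ th) => [f _ _ [q [Bq _] <-]|f g _ _ fg].
  by apply: pB; split=> //; exact: iB.
apply: dual_eq_on Bspan _ => b Bb; apply: (codeI _ _ I I).
by apply/funext => n; rewrite -!thE // fg.
Qed.

Lemma dual_lin_indep (F : fieldType) (V : lmodType F) (B : set V) :
  is_basis B -> infinite_set B ->
  exists2 L : set (dual V), lin_indep L & [set X : set V | X `<=` B] #<= L.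
Proof.
move=> Bbasis Binf; have [S SB Ssep] := independent_subsets Binf.
have /choice[f fE] X : exists f : dual V, forall b, B b -> f b = (b \in S X)%:R.
  exact: dual_extension.
(* Injectivity is separation from a single set. *)
have fI : inj_on [set X | X `<=` B] f.
  move=> X Y XB YB fXY; apply: contrapT => XY.
  have [||b SXb /(_ Y)/(_ (mem_head _ _)) SYb] := Ssep X [:: Y] XB.
  - by move=> Z; rewrite inE => /eqP->.
  - by rewrite inE; apply/eqP.
  have := fE X b (SB _ _ SXb); rewrite fXY fE; last exact: SB SXb.
  by rewrite (mem_set SXb) (memNset SYb) => /esym/eqP; rewrite oner_eq0.
exists (f @` [set X | X `<=` B]); last first.
  by apply: (@card_le_inj _ _ _ _ f) => // X XB; exists X.
move=> s c us sL s0 v vs.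
(* [k] recovers the subset behind a functional in [s]; elsewhere [set0] is a dummy. *)
have /choice[k kP] w : exists X : set V, w \in s -> X `<=` B /\ f X = w.
  have [/sL[X XB <-]|_] := boolP (w \in s); last by exists set0.
  by exists X.
(* At [b] the functional [v] is 1 and the others in [s] vanish, so evaluating the relation there
   leaves the coefficient of [v]. *)
have [|||b Skb nSb] := Ssep (k v) [seq k w | w <- rem v s].
- exact: (kP v vs).1.
- by move=> Y /mapP[w /mem_rem/kP[wB _] ->].
- apply/mapP => -[w wrem kvw]; have := wrem; rewrite mem_rem_uniq // inE.
  by rewrite -(kP v vs).2 -(kP w (mem_rem wrem)).2 kvw eqxx.
have Bb : B b := SB _ _ Skb.
have vb : v b = 1 by rewrite -{1}(kP v vs).2 fE // mem_set.
have := dual_sum_apply s c id b; rewrite s0 (big_rem v) //= big_seq big1.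
  by rewrite addr0 vb mulr1 => <-.
move=> w wrem; rewrite -{2}(kP w (mem_rem wrem)).2 fE // memNset ?mulr0 //.
by apply: nSb; exact: map_f.
Qed.

Theorem theorem2p9 (F : fieldType) (V : lmodType F)
    (hF : [set: F] #<= [set: set nat])
    (hV : infinite_dimensional V)
    (B : set V) (hB : is_basis B)
    (C : set (dual V)) (hC : is_basis C) :
  C #= [set X : set V | X `<=` B].
Proof.
have Binf : infinite_set B by move=> Bfin; apply: hV; exists B.
rewrite card_eq_le; apply/andP; split.
  exact: card_le_trans (card_leT C) (card_dual_le hF Binf hB.2).
have [L Lfree BL] := dual_lin_indep hB Binf.
exact: card_le_trans BL (lin_indep_card_le Lfree hC.2).
Qed.
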